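(* Let $n \ge 0$ and let $F$ be a field of characteristic $0$ or $p > n$. Then the Weyr structure (associated with the sole eigenvalue $1$) of the $n$th Sierpinski matrix $B_n$ over $F$ is the sequence of binomial coefficients $\frac{n!}{k!(n-k)!}$, $k = 0,1,\ldots,n$, arranged in decreasing (meaning non-increasing) order.
   Context: The Sierpinski matrices are defined inductively by $B_0 = [1]$ (a $1\times 1$ matrix) and $B_{n+1} = \begin{bmatrix} B_n & B_n \\ 0 & B_n \end{bmatrix}$ for $n \ge 0$, so $B_n$ is $2^n \times 2^n$. The Weyr structure of a square matrix $A$ associated with an eigenvalue $\lambda$ is the sequence $(n_1,\ldots,n_r)$, where $r$ is the least positive integer with $\operatorname{rank}(A-\lambda I)^r = \operatorname{rank}(A-\lambda I)^{r+1}$ and $n_i = \operatorname{rank}(A-\lambda I)^{i-1} - \operatorname{rank}(A-\lambda I)^i$ for $i=1,\ldots,r$. It satisfies $n_1 \ge n_2 \ge \cdots \ge n_r \ge 1$. *)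

(* Defs.v *)
From mathcomp Require Import all_boot all_order all_algebra.
Set Implicit Arguments.
Unset Strict Implicit.
Unset Printing Implicit Defensive.
Import GRing.Theory.
Local Open Scope ring_scope.

Lemma expn2S_double (n : nat) : (2 ^ n + 2 ^ n = 2 ^ n.+1)%N.
Proof. by rewrite addnn -mul2n expnS. Qed.

Fixpoint sierpinski (R : pzRingType) (n : nat) : 'M[R]_(2 ^ n) :=
  match n return 'M[R]_(2 ^ n) with
  | 0 => 1%:M
  | n'.+1 =>
      castmx (expn2S_double n', expn2S_double n')
        (block_mx (sierpinski R n') (sierpinski R n')
                  0                 (sierpinski R n'))
  end.

Definition power_rank (F : fieldType) (m : nat) (A : 'M[F]_m) (a : F)
    (i : nat) : nat :=
  \rank ((A - a%:M) ^+ i).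

Definition rank_stable (F : fieldType) (m : nat) (A : 'M[F]_m) (a : F)
    (r : nat) : bool :=
  (0 < r)%N && (power_rank A a r == power_rank A a r.+1).

Lemma power_rankS (F : fieldType) (m : nat) (A : 'M[F]_m) (a : F) (i : nat) :
  (power_rank A a i.+1 <= power_rank A a i)%N.
Proof. by rewrite /power_rank exprS; apply: mxrankM_maxr. Qed.

Lemma rank_stable_exists (F : fieldType) (m : nat) (A : 'M[F]_m) (a : F) :
  exists r, rank_stable A a r.
Proof.
suff [//|H] : (exists r, rank_stable A a r)
    \/ (power_rank A a m.+2 + m.+1 <= m)%N.
  by have := leq_trans (leq_addl _ _) H; rewrite ltnn.
elim: (m.+1) => [|k [IH|IH]]; [by right; rewrite addn0 rank_leq_row|by left|].
have [E|NE] := eqVneq (power_rank A a k.+1) (power_rank A a k.+2).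
  by left; exists k.+1; rewrite /rank_stable E eqxx.
right; apply: leq_trans IH; rewrite addnS -addSn leq_add2r.
by rewrite ltn_neqAle eq_sym NE power_rankS.
Qed.

Definition weyr_length (F : fieldType) (m : nat) (A : 'M[F]_m) (a : F) : nat :=
  ex_minn (rank_stable_exists A a).

(* The truncated subtraction is harmless by power_rankS. *)
Definition weyr_structure (F : fieldType) (m : nat) (A : 'M[F]_m) (a : F) :
    seq nat :=
  [seq (power_rank A a i.-1 - power_rank A a i)%N
     | i <- iota 1 (weyr_length A a)].

(* Main.v *)
(* Write N_n = B_n - 1. Since B_n commutes with N_n, the power N_{n+1}^(i+1) has
   diagonal blocks N_n^(i+1) and upper right block (i+1) N_n^i B_n. When i+1 is
   nonzero in F, the matrix (i+1) B_n is invertible and block elimination gives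
   rank N_{n+1}^(i+1) = rank N_n^i + rank N_n^(i+2). By Pascal's rule the
   successive rank drops of N_n are therefore 'C(n, floor((n - i) / 2)),
   0 <= i <= n, which are the binomial coefficients from the middle outwards. *)
Require Import Defs.
From mathcomp Require Import all_boot all_order all_algebra.
From mathcomp Require Import zify.
Import GRing.Theory.
Local Open Scope ring_scope.

Lemma castmx_exp (R : pzRingType) (m m' : nat) (e : m = m') (A : 'M[R]_m) i :
  castmx (e, e) A ^+ i = castmx (e, e) (A ^+ i).
Proof. by case: m' / e; rewrite !castmx_id. Qed.

(** The corner is the derivative of [X ^+ i.+1] at [A] in the direction [B], found by the product
    rule. *)
Lemma block_mx_exp (R : pzRingType) (m : nat) (A B : 'M[R]_m) i :
  GRing.comm A B ->
  block_mx A B 0 A ^+ i.+1 =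
  block_mx (A ^+ i.+1) (A ^+ i * (i.+1%:R * B)) 0 (A ^+ i.+1).
Proof.
move=> cAB; elim: i => [|i IHi]; first by rewrite !expr1 expr0 !mul1r.
rewrite exprS IHi -mulmxE mulmx_block !mulmxE !(mul0r, mulr0, addr0, add0r).
rewrite -exprS mulrA -exprS [B * _](commrX i.+1 (commr_sym cAB)).
by rewrite -mulrDr [i.+2%:R]mulrSr mulrDl mul1r.
Qed.

(** Block elimination with the invertible factor [C] of the corner as pivot: the matrix is [L],
    times a block diagonal matrix, times [S], with [L] and [S] invertible. *)
Lemma mxrank_block_exp (F : fieldType) (m : nat) (A C : 'M[F]_m) i :
  GRing.comm A C -> C \in unitmx ->
  \rank (block_mx (A ^+ i.+1) (A ^+ i * C) 0 (A ^+ i.+1)) =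
  (\rank (A ^+ i) + \rank (A ^+ i.+2))%N.
Proof.
move=> cAC uC; set V := invmx C.
have CV : C * V = 1 by apply: mulmxV.
have VC : V * C = 1 by apply: mulVmx.
have cAV : GRing.comm A V.
  by rewrite /GRing.comm -[LHS]mul1r -VC -mulrA [C * _]mulrA -cAC -!mulrA CV mulr1.
pose L : 'M_(m + m) := block_mx 1 0 (A * V) 1.
pose S : 'M_(m + m) := block_mx A C (- V) 0.
have uL : L \in unitmx by rewrite unitmxE det_lblock !det1 mulr1 unitr1.
have uS : S \in unitmx.
  suff /mulmx1_unit[] : S *m block_mx 0 (- C) V A = 1%:M by [].
  rewrite mulmx_block !mulmxE !(mulr0, mul0r, add0r, addr0) CV mulrN cAC addNr.
  by rewrite mulrN mulNr VC opprK -scalar_mx_block.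
have -> : block_mx (A ^+ i.+1) (A ^+ i * C) 0 (A ^+ i.+1) =
    L *m block_mx (A ^+ i) 0 0 (A ^+ i.+2) *m S.
  rewrite !mulmx_block !mulmxE !(mulr0, mul0r, mul1r, add0r, addr0) -exprSr.
  have AVX k : A * V * A ^+ k = A ^+ k.+1 * V.
    by rewrite -mulrA (commrX k (commr_sym cAV)) mulrA -exprS.
  congr block_mx; rewrite AVX -mulrA ?VC ?mulr1 //.
  by rewrite -cAV mulrA -exprSr mulrN subrr.
rewrite mxrankMfree ?row_free_unit // (eqmxMfull _ _) ?row_full_unit //.
exact: rank_diag_block_mx.
Qed.

Lemma sierpinskiS_sub1 (R : pzRingType) n (A := sierpinski R n - 1) :
  sierpinski R n.+1 - 1 =
  castmx (expn2S_double n, expn2S_double n) (block_mx A (sierpinski R n) 0 A).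
Proof.
rewrite /A /=; case: _ / (expn2S_double n); rewrite !castmx_id.
by rewrite [1](scalar_mx_block _ _ _) opp_block_mx add_block_mx !subr0.
Qed.

Lemma comm_sierpinski_sub1 (R : pzRingType) n :
  GRing.comm (sierpinski R n - 1) (sierpinski R n).
Proof. by apply: commr_sym; apply: commrB => //; apply: commr1. Qed.

Lemma sierpinski_unit (F : fieldType) n : sierpinski F n \in unitmx.
Proof.
elim: n => [|n IHn] /=; first exact: unitmx1.
case: _ / (expn2S_double n); rewrite castmx_id.
by rewrite unitmxE det_ublock unitrM -!unitmxE IHn.
Qed.

(** All blocks of the next power contain the factor [(sierpinski R n - 1) ^+ n.+1], so this holds in
    every characteristic. *)
Lemma sierpinski_sub1_nilp (R : pzRingType) n :
  (sierpinski R n - 1) ^+ n.+1 = 0.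
Proof.
elim: n => [|n IHn]; first by rewrite /= subrr expr1.
rewrite sierpinskiS_sub1 castmx_exp block_mx_exp; last exact: comm_sierpinski_sub1.
rewrite exprS IHn mulr0 mul0r block_mx_const.
by case: _ / (expn2S_double n); rewrite castmx_id.
Qed.

Lemma power_rank_sierpinski0 (F : fieldType) n :
  power_rank (sierpinski F n) 1 0 = (2 ^ n)%N.
Proof. by rewrite /power_rank expr0 mxrank1. Qed.

Lemma power_rank_sierpinski_eq0 (F : fieldType) n i : (n < i)%N ->
  power_rank (sierpinski F n) 1 i = 0%N.
Proof.
by move=> /subnKC <-; rewrite /power_rank exprD sierpinski_sub1_nilp mul0r mxrank0.
Qed.

Lemma power_rank_sierpinskiS (F : fieldType) n i : i.+1%:R != 0 :> F ->
  power_rank (sierpinski F n.+1) 1 i.+1 =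
  (power_rank (sierpinski F n) 1 i + power_rank (sierpinski F n) 1 i.+2)%N.
Proof.
move=> i_neq0; rewrite /power_rank sierpinskiS_sub1 castmx_exp.
case: _ / (expn2S_double n); rewrite castmx_id block_mx_exp; last exact: comm_sierpinski_sub1.
apply: mxrank_block_exp; first by apply: commrM (commr_nat _ _) (comm_sierpinski_sub1 _ _).
by rewrite mulr_natl -scaler_nat unitmxZ ?unitfE ?sierpinski_unit.
Qed.

(** Away from the boundary, the drop at [i.+1] for [n.+1] is the sum of the drops at [i] and [i.+2]
    for [n], which is Pascal's rule. *)
Lemma power_rank_sierpinski_drop (F : fieldType) n :
    (forall i, (0 < i <= n)%N -> i%:R != 0 :> F) ->
  forall i, (i <= n)%N ->
  power_rank (sierpinski F n) 1 i =
  ('C(n, (n - i)./2) + power_rank (sierpinski F n) 1 i.+1)%N.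
Proof.
elim: n => [|n IHn] n_neq0 i le_in.
  have -> : i = 0%N by lia.
  by rewrite power_rank_sierpinski0 power_rank_sierpinski_eq0.
have {}IHn j : (j <= n)%N -> power_rank (sierpinski F n) 1 j =
    ('C(n, (n - j)./2) + power_rank (sierpinski F n) 1 j.+1)%N.
  by apply: IHn => k ?; apply: n_neq0; lia.
case: i le_in => [_|i le_in].
  (* The rank recurrence starts at exponent 1. At exponent 0 the drop is the sum of the drops at 0
     and 1 one level down. *)
  have -> : power_rank (sierpinski F n.+1) 1 0 = (2 * power_rank (sierpinski F n) 1 0)%N.
    by rewrite !power_rank_sierpinski0 expnS.
  rewrite power_rank_sierpinskiS ?n_neq0 // mul2n -addnn addnCA; congr (_ + _)%N.
  case: n IHn {n_neq0} => [|n] IHn; first by rewrite IHn // !power_rank_sierpinski_eq0.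
  rewrite (IHn 0%N) // (IHn 1%N) // addnA; congr (_ + _)%N.
  rewrite !subn0 subSS subn0 (_ : n.+2./2 = n./2.+1) // [RHS]binS; congr (_ + _)%N.
  (* For even [n], row [n.+1] has two equal central coefficients, exchanged by symmetry. *)
  have [o|e] := boolP (odd n); first by congr binomial; lia.
  by rewrite -bin_sub; [congr binomial|]; lia.
rewrite power_rank_sierpinskiS ?n_neq0 // (IHn i) // subSS.
(* At [i = n] the scalar [i.+2] may vanish in [F], so nilpotency replaces the recurrence. *)
have [lt_in|le_ni] := ltnP i n; last first.
  have -> : i = n by lia.
  by rewrite subnn !bin0 !power_rank_sierpinski_eq0.
rewrite power_rank_sierpinskiS ?n_neq0 //.
(* If [i.+1 = n], the drop at [i.+2] is zero and only ['C(n, 0)] remains. *)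
have [lt_i1n|le_ni1] := ltnP i.+1 n; last first.
  have -> : (n - i)./2 = 0%N by lia.
  by rewrite !bin0 (power_rank_sierpinski_eq0 F n i.+2) ?(power_rank_sierpinski_eq0 F n i.+3) //; lia.
have -> : (n - i)./2 = (n - i.+2)./2.+1 by lia.
rewrite (IHn i.+2) // binS; lia.
Qed.

Lemma leq_bin_half n k l : (k <= l)%N -> (l <= n./2)%N -> ('C(n, k) <= 'C(n, l))%N.
Proof.
move=> /subnKC <-; elim: (l - k)%N => [|d IHd] le_n; first by rewrite addn0.
apply: leq_trans (IHd _) _; first lia.
rewrite addnS; set j := (k + d)%N.
(* Consecutive coefficients have ratio [(n - j) / j.+1], at least 1 below the middle. *)
rewrite -(leq_pmul2l (ltn0Sn j)) mul_bin_left leq_mul2r; lia.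
Qed.

Lemma sort_bin n :
  sort geq [seq 'C(n, k) | k <- iota 0 n.+1] =
  [seq 'C(n, (n - i)./2) | i <- iota 0 n.+1].
Proof.
have anti_geq : antisymmetric geq by move=> x y; rewrite andbC; apply: anti_leq.
have tr_geq : transitive geq by move=> y x z /= *; lia.
apply: (sorted_eq tr_geq anti_geq).
- by apply: sort_sorted => x y; apply: leq_total.
- rewrite sorted_map; apply: sub_sorted (iota_sorted 0 n.+1) => i j /= le_ij.
  by apply: leq_bin_half; lia.
rewrite perm_sort.
(* Halving hits lower indices twice; reflecting the odd case across the middle makes [f] a
   permutation of [0..n] with the same binomial values. *)
pose f i := (if odd (n - i) then n - (n - i)./2 else (n - i)./2)%N.
have f_bin i : (i <= n)%N -> 'C(n, (n - i)./2) = 'C(n, f i).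
  by rewrite /f; case: ifP => // _ le_in; rewrite bin_sub //; lia.
have -> : [seq 'C(n, (n - i)./2) | i <- iota 0 n.+1] =
    [seq 'C(n, k) | k <- [seq f i | i <- iota 0 n.+1]].
  by rewrite -map_comp; apply/eq_in_map => i; rewrite mem_iota => ?; apply: f_bin; lia.
apply: perm_map; rewrite perm_sym.
have uniq_f : uniq [seq f i | i <- iota 0 n.+1].
  rewrite map_inj_in_uniq ?iota_uniq // => i j; rewrite !mem_iota /f => ? ?.
  by case: ifP; case: ifP; lia.
apply: (uniq_perm uniq_f (iota_uniq 0 n.+1)).
apply: (uniq_min_size uniq_f _ _).2; last by rewrite size_map !size_iota.
by move=> k /mapP[i]; rewrite !mem_iota => ? ->; rewrite /f; case: ifP; lia.
Qed.

(** Nilpotency of [sierpinski F n - 1] forces [a = 1]; the rank bound gives that matrix a nonzero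
    kernel. *)
Lemma eigenvalue_sierpinski (F : fieldType) n (a : F) :
  (power_rank (sierpinski F n) 1 1 < 2 ^ n)%N ->
  eigenvalue (sierpinski F n) a = (a == 1).
Proof.
move=> rk_lt; apply/idP/eqP => [/eigenvalueP[v vB v_neq0]|->]; last first.
  rewrite /eigenvalue /eigenspace -mxrank_eq0 mxrank_ker subn_eq0 -ltnNge.
  by move: rk_lt; rewrite /power_rank expr1.
have vN k : v *m (sierpinski F n - 1) ^+ k = (a - 1) ^+ k *: v.
  elim: k => [|k IHk]; first by rewrite !expr0 mulmx1 scale1r.
  rewrite exprSr -mulmxE mulmxA IHk -scalemxAl mulmxBr vB mulmx1.
  by rewrite exprSr -scalerA scalerBl scale1r.
move: (vN n.+1); rewrite sierpinski_sub1_nilp mulmx0 => /esym/eqP.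
by rewrite scaler_eq0 (negPf v_neq0) orbF expf_eq0 subr_eq0 => /andP[_ /eqP].
Qed.

Lemma weyr_length_eq (F : fieldType) m (A : 'M[F]_m) (a : F) n :
  (forall i, (i <= n)%N -> power_rank A a i.+1 < power_rank A a i)%N ->
  power_rank A a n.+1 = 0%N -> weyr_length A a = n.+1.
Proof.
move=> drop rk0; rewrite /weyr_length; case: ex_minnP => r /andP[r_gt0 /eqP r_st] r_min.
have rk0S : power_rank A a n.+2 = 0%N by have := power_rankS A a n.+1; lia.
have le_rn : (r <= n.+1)%N by apply: r_min; rewrite /rank_stable rk0 rk0S.
have [le_r|] := leqP r n; last lia.
by have := drop r le_r; lia.
Qed.

Theorem corollary3p3 (n : nat) (F : fieldType)
    (charF : [pchar F] =i pred0 \/ (exists2 p : nat, p \in [pchar F] & (n < p)%N)) :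
  (forall a : F, eigenvalue (sierpinski F n) a = (a == 1)) /\
  weyr_structure (sierpinski F n) 1
    = sort geq [seq 'C(n, k) | k <- iota 0 n.+1].
Proof.
have n_neq0 i : (0 < i <= n)%N -> i%:R != 0 :> F.
  case/andP=> i_gt0 le_in; case: charF => [/pcharf0P->|[p pF lt_np]]; first by lia.
  by rewrite -(dvdn_pcharf pF) gtnNdvd //; lia.
have drop := power_rank_sierpinski_drop F n n_neq0.
have drop_gt0 i : (i <= n)%N -> (0 < 'C(n, (n - i)./2))%N by rewrite bin_gt0; lia.
split=> [a|].
  apply: eigenvalue_sierpinski.
  by have := drop_gt0 0%N isT; have := drop 0%N isT; rewrite power_rank_sierpinski0; lia.
rewrite /weyr_structure (weyr_length_eq _ _ _ _ n); last 2 first.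
- by move=> i le_in; have := drop_gt0 i le_in; have := drop i le_in; lia.
- exact: power_rank_sierpinski_eq0.
(* Weyr indices start at 1, drops at 0, hence the shift. *)
rewrite sort_bin (iotaDl 1 0) -map_comp; apply/eq_in_map => i.
by rewrite mem_iota => i_lt /=; rewrite drop ?add1n ?addnK //; lia.
Qed.
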